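(* Suppose polynomials $A,E,D$ and a function $a_{in}$ satisfy 1. $\deg(A),\deg(E),\deg(D)\le n$; 2. $E^{\sim n}=E$; 3. $D(\lambda)\ne0$ on $\overline{\mathbb{D}}$; 4. $|E(\lambda)|\le2|D(\lambda)|$ on $\overline{\mathbb{D}}$; 5. $A$ is an outer polynomial such that $|A(\lambda)|^2=|D(\lambda)|^2-\frac14|E(\lambda)|^2$ for $\lambda\in\mathbb{T}$; 6. $a_{in}$ is a rational inner function on $\mathbb{D}$ of degree $\le m$. Let $a,s,p$ be defined on $\overline{\mathbb{D}}$ by $$a=a_{in}\frac{A}{D},\qquad s=\frac{E}{D},\qquad p=\frac{D^{\sim n}}{D}.$$ Then $x=(a,s,p)=\Big(a_{in}\dfrac{A}{D},\dfrac{E}{D},\dfrac{D^{\sim n}}{D}\Big)$ is a rational $\overline{\mathcal{P}}$-inner function of degree less than or equal to $(m+n,n)$.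
   Context: $\mathbb{D}$ is the open unit disc in $\mathbb{C}$, $\mathbb{T}$ the unit circle. $\mathbb{B}^{2\times2}$ is the open unit ball of the complex $2\times2$ matrices in the operator norm. The pentablock is $\mathcal{P}=\{(a_{21},\operatorname{tr}A,\det A): A=[a_{ij}]_{i,j=1}^2\in\mathbb{B}^{2\times2}\}\subset\mathbb{C}^3$, with closure $\overline{\mathcal{P}}$ and distinguished boundary $$b\overline{\mathcal{P}}=\Big\{(a,s,p)\in\mathbb{C}^3: |s|\le2,\ |p|=1,\ s=\overline{s}p,\ |a|=\sqrt{1-\tfrac14|s|^2}\Big\}.$$ A rational $\overline{\mathcal{P}}$-inner function is a rational analytic map $x:\mathbb{D}\to\overline{\mathcal{P}}$ (which extends continuously to $\overline{\mathbb{D}}$) that maps $\mathbb{T}$ into $b\overline{\mathcal{P}}$. Its degree is the pair $(\deg a,\deg p)$ of degrees of the rational functions $a$ and $p$; degree $\le(m,n)$ means $\deg a\le m$ and $\deg p\le n$. For a polynomial $g$ of degree at most $n$, $g^{\sim n}(\lambda)=\lambda^n\overline{g(1/\overline{\lambda})}$. A polynomial is outer if it has no zeros in $\mathbb{D}$. Rational inner functions on $\mathbb{D}$ are exactly the finite Blaschke products (including unimodular constants). *)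

(* Defs.v *)
From HB Require Import structures.
From mathcomp Require Import all_boot all_order all_algebra.
From mathcomp Require Import all_classical all_reals all_analysis.
From mathcomp Require Import complex.

Set Implicit Arguments.
Unset Strict Implicit.
Unset Printing Implicit Defensive.

Import Order.TTheory GRing.Theory Num.Theory numFieldNormedType.Exports.

Local Open Scope classical_set_scope.
Local Open Scope ring_scope.

(* [R[i]] packed as a [numClosedFieldType]: in this form it inherits the metric
   topology and the normed-module structure of an arbitrary [numFieldType], so
   that [derivable] below is differentiability over the complex scalars. *)
Definition Cx (R : realType) : numClosedFieldType := R[i].

Definition disc (R : realType) : set (Cx R) := [set z | `|z| < 1].
Definition closed_disc (R : realType) : set (Cx R) := [set z | `|z| <= 1].
Definition circle (R : realType) : set (Cx R) := [set z | `|z| = 1].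

Definition vnorm (R : realType) (v : 'cV[Cx R]_2) : R :=
  Num.sqrt (\sum_i ComplexField.Normc.normc (v i 0) ^+ 2).

Definition opnorm (R : realType) (A : 'M[Cx R]_2) : R :=
  sup [set vnorm (A *m v) | v in [set v | vnorm v <= 1]].

(* Matrix indices start at 0, so [A 1 0] is the entry a_21. *)
Definition pentablock (R : realType) : set (Cx R * Cx R * Cx R) :=
  [set (A 1 0, \tr A, \det A) | A in [set A : 'M[Cx R]_2 | opnorm A < 1]].

Definition pentablock_boundary (R : realType) : set (Cx R * Cx R * Cx R) :=
  [set x | let: (a, s, p) := x in
    [/\ `|s| <= 2, `|p| = 1, s = s^* * p & `|a| = sqrtC (1 - `|s| ^+ 2 / 4)]].

(* [f] is the rational function P/Q in lowest terms, at the points of the disc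
   that are not zeros of Q. *)
Definition represents (R : realType) (f : Cx R -> Cx R) (P Q : {poly Cx R}) :=
  [/\ Q != 0, coprimep P Q
    & forall z, disc z -> Q.[z] != 0 -> f z = P.[z] / Q.[z]].

Definition rational_degree (R : realType) (f : Cx R -> Cx R) (d : nat) :=
  exists P Q, represents f P Q /\ d = maxn (size P).-1 (size Q).-1.

(* Functions are total in Rocq; only the values on the closed disc matter. *)
Definition rational_analytic (R : realType) (f : Cx R -> Cx R) :=
  [/\ exists P Q, represents f P Q,
      forall z, disc z -> derivable f z 1
    & {within @closed_disc R, continuous f}].

Definition rational_inner (R : realType) (f : Cx R -> Cx R) :=
  [/\ rational_analytic f,
      forall z, disc z -> `|f z| <= 1
    & forall z, circle z -> `|f z| = 1].

Definition rational_pentablock_inner (R : realType)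
    (x : Cx R -> Cx R * Cx R * Cx R) :=
  [/\ [/\ rational_analytic (fun z => (x z).1.1),
          rational_analytic (fun z => (x z).1.2)
        & rational_analytic (fun z => (x z).2)],
      forall z, disc z -> closure (@pentablock R) (x z)
    & forall z, circle z -> pentablock_boundary (x z)].

Definition pentablock_degree (R : realType) (x : Cx R -> Cx R * Cx R * Cx R)
    (d : nat * nat) :=
  rational_degree (fun z => (x z).1.1) d.1 /\
  rational_degree (fun z => (x z).2) d.2.

Definition outer_poly (R : realType) (A : {poly Cx R}) :=
  forall z, disc z -> A.[z] != 0.

(* The coefficient form of z ^ n * conj (g (1 / conj z)), see [horner_reflect]. *)
Definition reflect_poly (R : realType) (n : nat) (g : {poly Cx R}) :
    {poly Cx R} := \poly_(i < n.+1) (g`_(n - i))^*.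

Lemma horner_reflect (R : realType) (n : nat) (g : {poly Cx R}) (z : Cx R) :
  (size g <= n.+1)%N -> z != 0 ->
  (reflect_poly n g).[z] = z ^+ n * (g.[1 / z^*])^*.
Proof.
move=> sg z0; rewrite horner_poly (horner_coef_wide _ sg) rmorph_sum mulr_sumr.
rewrite (reindex_inj rev_ord_inj); apply: eq_bigr => i _ /=.
rewrite subSS subKn -1?ltnS // rmorphM rmorphXn fmorph_div rmorph1 /= conjCK.
rewrite mulrCA div1r exprVn; congr (_ * _).
by rewrite -exprB ?unitfE // -ltnS.
Qed.

Lemma rational_degree_uniq (R : realType) (f : Cx R -> Cx R) (d1 d2 : nat) :
  rational_degree f d1 -> rational_degree f d2 -> d1 = d2.
Proof.
move=> [P1 [Q1 [[Q10 cop1 f1] ->]]] [P2 [Q2 [[Q20 cop2 f2] ->]]].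
have eqPQ : P1 * Q2 = P2 * Q1.
  apply/eqP; rewrite -subr_eq0; apply/negPn/negP => nz.
  pose S := (P1 * Q2 - P2 * Q1) * (Q1 * Q2).
  have S0 : S != 0 by rewrite !mulf_neq0.
  pose rs : seq (Cx R) := [seq k.+2%:R^-1 | k <- iota 0 (size S)].
  have urs : uniq rs.
    rewrite map_inj_uniq ?iota_uniq // => i j /invr_inj /eqP.
    by rewrite eqr_nat => /eqP [].
  suff : all (root S) rs.
    by move=> /(max_poly_roots S0) /(_ urs); rewrite size_map size_iota ltnn.
  apply/allP => _ /mapP [k _ ->]; set z : Cx R := k.+2%:R^-1.
  have dz : disc z.
    by rewrite /disc /= /z normfV normr_nat invf_lt1 ?ltr1n ?ltr0n.
  rewrite /root /S !hornerE /= !mulf_eq0.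
  have [//|q1] := eqVneq Q1.[z] 0; first by rewrite orbT.
  have [//|q2] := eqVneq Q2.[z] 0; first by rewrite orbT.
  have /eqP := f1 z dz q1; rewrite (f2 z dz q2) eqr_div // => /eqP ->.
  by rewrite subrr eqxx.
have dQ12 : Q1 %| Q2.
  have c1 : coprimep Q1 P1 by rewrite coprimep_sym.
  by rewrite -(Gauss_dvdpr _ c1) eqPQ dvdp_mull.
have dQ21 : Q2 %| Q1.
  have c2 : coprimep Q2 P2 by rewrite coprimep_sym.
  by rewrite -(Gauss_dvdpr _ c2) -eqPQ dvdp_mull.
have sQ : size Q1 = size Q2.
  by apply/eqP; rewrite eqn_leq !dvdp_leq.
have sP : size P1 = size P2.
  have [P10|P10] := eqVneq P1 0.
    have /eqP : P2 * Q1 = 0 by rewrite -eqPQ P10 mul0r.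
    by rewrite mulf_eq0 (negbTE Q10) orbF P10 => /eqP ->.
  have P20 : P2 != 0.
    apply/negP => /eqP P20; have /eqP : P1 * Q2 = 0 by rewrite eqPQ P20 mul0r.
    by rewrite mulf_eq0 (negbTE Q20) (negbTE P10).
  have /(congr1 (fun p : {poly Cx R} => (size p).-1)) := eqPQ.
  have sQ1 : (0 < size Q1)%N by rewrite size_poly_gt0.
  have sP1 : (0 < size P1)%N by rewrite size_poly_gt0.
  have sP2 : (0 < size P2)%N by rewrite size_poly_gt0.
  rewrite !size_mul // -sQ -(prednK sQ1) !addnS /=.
  by rewrite -(prednK sP1) -(prednK sP2) !addSn /= => /addIn ->.
by rewrite sQ sP.
Qed.

(* Main.v *)
Require Import Defs.
From HB Require Import structures.
From mathcomp Require Import all_boot all_order all_algebra.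
From mathcomp Require Import all_classical all_reals all_analysis.
From mathcomp Require Import complex.
From mathcomp Require Import cyclic separable cyclotomic ring.

(** The triple comes from a matrix-valued inner function. Writing [A~] and [D~]
    for the reflections of [A] and [D], put

      [F = [[E / 2D, - A~ / D], [A / D, E / 2D]]].

    On the circle, [E = z ^+ n * E^*] and the formula for [`|A| ^+ 2] say exactly
    that [F] is unitary ([realization_isometry]), and they give the polynomial
    identity [E ^+ 2 / 4 + A * A~ = D * D~], that is, [\det F = D~ / D]
    ([det_realization]). Since [D] has no zero on the closed disc, the maximum
    principle makes [F.[z]] a contraction at every point [z] of the disc
    ([realization_contraction]). Its entry (2,1), trace and determinant are
    [A / D], [E / D] and [D~ / D], so that the triple lies in the closed pentablock
    ([closure_pentablock]) when the inner factor is 1.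

    The inner factor is a number [w] with [`|w| <= 1] at each point of the disc. A
    contraction [[[h, b], [a, h]]] is unitarily similar to a matrix whose entry
    (2,1) is [w * a] ([contraction_shrink]); the similarity keeps trace and
    determinant, so multiplying the first coordinate by [w] stays in the closed
    pentablock.

    The maximum principle ([max_principle]) is needed only for quotients of
    polynomials, and is obtained algebraically. For a polynomial, averages over
    roots of unity give Cauchy's estimates, and a power trick sharpens the
    resulting bound ([poly_max_principle]); zeros of the denominator are then
    removed one at a time by truncated geometric series.

    For the degrees, a rational function in lowest terms that is continuous on the
    disc has no pole there ([represents_denominator_neq0]), so the products and
    quotients of the defining polynomials represent the coordinates on the whole
    disc, and cancelling common factors cannot raise the degree. *)

Set Implicit Arguments.
Unset Strict Implicit.
Unset Printing Implicit Defensive.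

Import Order.TTheory GRing.Theory Num.Theory numFieldNormedType.Exports.

Local Open Scope classical_set_scope.
Local Open Scope ring_scope.

(** * The maximum principle *)

(** ['X^n - 1] is separable in characteristic 0, so it has [n] distinct roots. *)
Lemma closed_prim_root_exists (C : numClosedFieldType) (n : nat) :
  (0 < n)%N -> exists w : C, n.-primitive_root w.
Proof.
move=> n_gt0; pose p : {poly C} := 'X^n - 1.
have [r Dp] := closed_field_poly_normal p.
rewrite (monicP _) ?monicXnsubC // scale1r in Dp.
have rn1 : all n.-unity_root r by apply/allP=> z; rewrite -root_prod_XsubC -Dp.
have sz_r : (n < (size r).+1)%N.
  by rewrite -(size_prod_XsubC r id) -Dp size_XnsubC.
have [|w] := hasP (has_prim_root n_gt0 rn1 _ sz_r); last by exists w.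
by rewrite -separable_prod_XsubC -Dp separable_Xn_sub_1 // pnatr_eq0 -lt0n.
Qed.

Lemma sum_prim_root (C : numClosedFieldType) (n k : nat) (w : C) :
  n.-primitive_root w ->
  \sum_(i < n) w ^+ (k * i) = if (n %| k)%N then n%:R else 0.
Proof.
move=> prim_w; have -> : \sum_(i < n) w ^+ (k * i) = \sum_(i < n) (w ^+ k) ^+ i.
  by apply: eq_bigr => i _; rewrite exprM.
rewrite (prim_order_dvd prim_w); have [-> | nz] := eqVneq.
  by under eq_bigr do rewrite expr1n; rewrite sumr_const card_ord.
have := subrX1 (w ^+ k) n; rewrite -exprM mulnC exprM (prim_expr_order prim_w).
by rewrite expr1n subrr => /esym/eqP; rewrite mulf_eq0 subr_eq0 (negPf nz) => /eqP.
Qed.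

(** Cauchy's estimate. For [N] larger than the degree, averaging
    [H.[w] * w ^- j] over the [N]-th roots of unity [w] returns the coefficient
    [H`_j] exactly, so no integral is needed. *)
Lemma coef_le_circle (C : numClosedFieldType) (H : {poly C}) (M : C) (j : nat) :
  (forall z : C, `|z| = 1 -> `|H.[z]| <= M) -> `|H`_j| <= M.
Proof.
move=> HM; have [szj|jsz] := leqP (size H) j.
  rewrite nth_default // normr0; apply: le_trans (HM 1 (normr1 _)); exact: normr_ge0.
have N_gt0 : (0 < size H)%N by apply: leq_ltn_trans jsz.
set N := size H in jsz N_gt0 *.
have [w prim_w] := closed_prim_root_exists C N_gt0.
have w1 i : `|w ^+ i| = 1.
  apply/eqP; rewrite -(pexpr_eq1 N_gt0 (normr_ge0 _)) -normrX exprAC.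
  by rewrite (prim_expr_order prim_w) expr1n normr1.
have key : N%:R * H`_j = \sum_(i < N) H.[w ^+ i] * w ^+ ((N - j) * i).
  transitivity (\sum_(l < N) H`_l * \sum_(i < N) w ^+ ((l + (N - j)) * i)).
    rewrite (bigD1 (Ordinal jsz)) //= [X in _ + X]big1 ?addr0 => [|l nlj].
      by rewrite sum_prim_root // subnKC 1?ltnW // dvdnn mulrC.
    rewrite sum_prim_root //; case: ifP => [|_]; last by rewrite mulr0.
    have ltlj : (l + (N - j) < N + N)%N.
      by rewrite -addSn leq_add ?leq_subr.
    have neq : (l + (N - j) != N)%N.
      apply: contraNneq nlj => e; apply/eqP/val_inj => /=.
      by apply/eqP; rewrite -(eqn_add2r (N - j)) e subnKC // ltnW.
    (* [l + (N - j)] lies in [1, 2N - 1], so it can only be the multiple [N]. *)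
    case/dvdnP => q; case: q => [|[|q]] Eq; last 1 first.
    - by move: ltlj; rewrite Eq !mulSn addnA -[X in (_ < X)%N]addn0 ltn_add2l.
    - by move/eqP: Eq; rewrite addn_eq0 subn_eq0 leqNgt jsz andbF.
    - by rewrite Eq mul1n eqxx in neq.
  under eq_bigr do rewrite mulr_sumr.
  rewrite exchange_big; apply: eq_bigr => i _ /=.
  rewrite horner_coef mulr_suml; apply: eq_bigr => l _.
  by rewrite mulnDl exprD -exprM mulrA (mulnC i).
rewrite -(ler_pM2l (_ : 0 < N%:R)) ?ltr0n //.
rewrite -[X in X * `|_|](normr_nat C) -normrM key.
apply: le_trans (ler_norm_sum _ _ _) _.
apply: (@le_trans _ _ (\sum_(i < N) M)).
  by apply: ler_sum => i _; rewrite normrM w1 mulr1 HM.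
by rewrite sumr_const card_ord mulr_natl.
Qed.

(** A crude bound inside the disc, from Cauchy's estimate and the geometric
    series. What matters is that the factor [1 - `|z|] does not depend on [H]:
    applied to the powers of [H] it disappears in the limit. *)
Lemma horner_le_circle (C : numClosedFieldType) (H : {poly C}) (M z : C) :
  (forall z : C, `|z| = 1 -> `|H.[z]| <= M) -> `|z| < 1 ->
  `|H.[z]| * (1 - `|z|) <= M.
Proof.
move=> HM z1; have M0 : 0 <= M by apply: le_trans (HM 1 (normr1 _)).
have z1' : 0 < 1 - `|z| by rewrite subr_gt0.
apply: (@le_trans _ _ ((\sum_(i < size H) M * `|z| ^+ i) * (1 - `|z|))).
  rewrite ler_pM2r // horner_coef; apply: le_trans (ler_norm_sum _ _ _) _.
  apply: ler_sum => i _; rewrite normrM normrX ler_wpM2r ?exprn_ge0 //.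
  exact: coef_le_circle.
rewrite -mulr_sumr -mulrA -[leRHS]mulr1 ler_wpM2l //.
rewrite [_ * (1 - _)]mulrC -opprB mulNr -subrX1 opprB lerBlDr lerDl exprn_ge0 //.
Qed.

Lemma Cx_archi (R : realType) (x : Cx R) : exists k : nat, `|x| < k%:R.
Proof.
have /complex_realP[r xr] : (`|x| : R[i]) \is Num.real by exact: normr_real.
exists (Num.bound `|r|).
have -> : (Num.bound `|r|)%:R = real_complex R (Num.bound `|r|)%:R :> Cx R.
  by rewrite rmorph_nat.
rewrite xr ltcR; apply: le_lt_trans (ler_norm r) _.
exact: archi_boundP (normr_ge0 _).
Qed.

(** Bernoulli's inequality: [h ^+ k] grows at least like [k * (h - 1)]. *)
Lemma le1_of_bounded_exp (R : realType) (h B : Cx R) :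
  0 <= h -> (forall k : nat, h ^+ k <= B) -> h <= 1.
Proof.
move=> h0 hB; rewrite real_leNgt ?ger0_real // ?ler01 //; apply/negP => h1.
have [k] := Cx_archi (B / (h - 1)).
have d0 : 0 < h - 1 by rewrite subr_gt0.
have B0 : 0 <= B by apply: le_trans (hB 0%N); rewrite expr0.
rewrite ger0_norm ?divr_ge0 // ?ltW // ltr_pdivrMr //.
apply/negP; rewrite -real_leNgt ?realM ?ger0_real // ?(ltW d0) //.
apply: le_trans (hB k); elim: k => [|k IH]; first by rewrite mul0r expr0.
have -> : h ^+ k.+1 = h ^+ k + (h - 1) * h ^+ k by rewrite exprS; ring.
rewrite -natr1 mulrDl mul1r lerD //.
by rewrite ler_peMr ?exprn_ege1 ?(ltW d0) ?(ltW h1).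
Qed.

(** The power trick: [horner_le_circle] for [H ^+ k] bounds
    [(`|H.[z]| / M) ^+ k] by [(1 - `|z|)^-1] for every [k]. *)
Lemma poly_max_principle (R : realType) (H : {poly Cx R}) (M z : Cx R) :
  (forall z, circle z -> `|H.[z]| <= M) -> disc z -> `|H.[z]| <= M.
Proof.
rewrite /disc /circle /= => HM z1.
(* The ratio is only formed for a positive bound; [M] may vanish. *)
suff strict N :
    0 < N -> (forall z : Cx R, `|z| = 1 -> `|H.[z]| <= N) -> `|H.[z]| <= N.
  have M0 : 0 <= M by apply: le_trans (HM 1 (normr1 _)).
  apply/ler_addgt0Pr => e e0; apply: strict; first by rewrite ltr_wpDl.
  by move=> u u1; apply: le_trans (HM u u1) _; rewrite lerDl ltW.
move=> N0 HN; rewrite -[leRHS]mul1r -ler_pdivrMr //.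
apply: (@le1_of_bounded_exp _ _ (1 - `|z|)^-1); first by rewrite divr_ge0 // ltW.
move=> k; rewrite -[leRHS]mul1r ler_pdivlMr ?subr_gt0 //.
rewrite expr_div_n mulrAC ler_pdivrMr ?exprn_gt0 // mul1r -normrX -horner_exp.
apply: horner_le_circle => // u u1; rewrite horner_exp normrX.
by apply: lerXn2r; rewrite ?nnegrE ?(ltW N0) ?normr_ge0 ?HN.
Qed.

(** Induction on the zeros [d] of the denominator. As [`|d| > 1], the factor
    [(z - d)^-1] is, up to the constant [- d ^+ k], approximated by the
    truncated geometric series [T] with [(z - d) * T.[z] = z ^+ k - d ^+ k].
    Multiplying [P] by [T] removes the zero [d] at the price of constants
    [`|d| ^+ k - 1] and [`|d| ^+ k + 1], whose ratio tends to 1. *)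
Lemma max_principle_prod (R : realType) (rs : seq (Cx R)) :
  (forall d, d \in rs -> ~ closed_disc d) ->
  forall (P : {poly Cx R}) (c : Cx R),
    (forall z, circle z -> `|P.[z]| <= c * `|\prod_(d <- rs) (z - d)|) ->
  forall z, disc z -> `|P.[z]| <= c * `|\prod_(d <- rs) (z - d)|.
Proof.
elim: rs => [|d rs IH] rsP P c Pc z z1.
  rewrite big_nil normr1 mulr1; apply: poly_max_principle z1 => u u1.
  by have := Pc u u1; rewrite big_nil normr1 mulr1.
have d1 : 1 < `|d|.
  rewrite real_ltNge ?ger0_real ?ler01 //; apply/negP.
  by apply: rsP; rewrite mem_head.
have rsP' e : e \in rs -> ~ closed_disc e.
  by move=> ers; apply: rsP; rewrite in_cons ers orbT.
have bound k : `|P.[z]| * (`|d| ^+ k - 1) <=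
               c * `|\prod_(d <- d :: rs) (z - d)| * (`|d| ^+ k + 1).
  pose T : {poly Cx R} := \sum_(i < k) (d ^+ i)%:P * 'X^(k.-1 - i).
  have TE u : (u - d) * T.[u] = u ^+ k - d ^+ k.
    rewrite subrXX; congr (_ * _); rewrite horner_sum; apply: eq_bigr => i _.
    by rewrite !hornerE mulrC.
  have h Pu := IH rsP' (P * T) (c * (`|d| ^+ k + 1)) Pu z z1.
  rewrite big_cons normrM.
  apply: (@le_trans _ _ (`|z - d| * (`|P.[z]| * `|T.[z]|))).
    rewrite mulrCA -normrM TE ler_wpM2l // distrC -normrX.
    apply: le_trans (lerB_dist _ _); rewrite lerD2l lerN2 normrX.
    by rewrite exprn_ile1 // ltW.
  rewrite [leRHS](_ : _ = `|z - d| *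
     (c * (`|d| ^+ k + 1) * `|\prod_(d <- rs) (z - d)|)); last by ring.
  rewrite ler_wpM2l // -normrM -hornerM h // => u u1.
  have ud : 0 < `|u - d|.
    rewrite normr_gt0 subr_eq0; apply/eqP => ud.
    by move: d1; rewrite -ud u1 ltxx.
  rewrite -(ler_pM2l ud) hornerM -normrM mulrCA TE normrM.
  have := Pc u u1; rewrite big_cons normrM => Pu.
  apply: (@le_trans _ _
     (c * (`|u - d| * `|\prod_(j <- rs) (u - j)|) * (`|d| ^+ k + 1))).
    apply: ler_pM => //; apply: le_trans (ler_normB _ _) _.
    by rewrite !normrX u1 expr1n addrC.
  by rewrite le_eqVlt; apply/orP; left; apply/eqP; ring.
(* If [Y < X], then [bound] makes the powers of [`|d|] bounded. *)
set X := `|P.[z]| in bound *; set Y := c * _ in bound *.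
have Xr : X \is Num.real by exact: normr_real.
(* [c] is real: at the point 1 of the circle, [c * w] bounds a norm for some
   [w > 0]. *)
have Yr : Y \is Num.real.
  rewrite realM ?normr_real //.
  have := Pc 1 (normr1 _); set w := `|\prod_(_ <- _) _| => h.
  have w0 : 0 < w.
    rewrite normr_gt0 prodf_seq_neq0; apply/allP => e ers /=.
    apply/negP; rewrite subr_eq0 => /eqP e1.
    by apply: (rsP e ers); rewrite /closed_disc /= -e1 normr1.
  by rewrite ger0_real // -(pmulr_lge0 _ w0); apply: le_trans h.
rewrite real_leNgt //; apply/negP => YX.
have : `|d| <= 1.
  apply: (@le1_of_bounded_exp _ _ ((X + Y) / (X - Y))) => // k.
  rewrite ler_pdivlMr ?subr_gt0 // -subr_ge0.
  rewrite [X in 0 <= X](_ : _ = Y * (`|d| ^+ k + 1) - X * (`|d| ^+ k - 1)).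
    by rewrite subr_ge0.
  by ring.
by rewrite real_leNgt ?ger0_real ?ler01 // d1.
Qed.

Lemma max_principle (R : realType) (P D : {poly Cx R}) (c : Cx R) :
  (forall z, closed_disc z -> D.[z] != 0) ->
  (forall z, circle z -> `|P.[z]| <= c * `|D.[z]|) ->
  forall z, disc z -> `|P.[z]| <= c * `|D.[z]|.
Proof.
move=> D0 PD; have [rs Drs] := closed_field_poly_normal D.
have DE z : c * `|D.[z]| = c * `|lead_coef D| * `|\prod_(d <- rs) (z - d)|.
  rewrite -mulrA {1}Drs hornerZ normrM horner_prod; congr (_ * (_ * `|_|)).
  by apply: eq_bigr => d _; rewrite hornerXsubC.
move=> z z1; rewrite DE; apply: max_principle_prod z1 => [d drs d1|u u1].
  have /eqP := D0 d d1; apply; rewrite Drs.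
  by rewrite hornerZ (rootP _) ?mulr0 // root_prod_XsubC.
by rewrite -DE; exact: PD.
Qed.

(** * Contractive 2 x 2 matrices *)

Definition sqnorm (C : numClosedFieldType) (v : 'cV[C]_2) : C :=
  \sum_i `|v i 0| ^+ 2.

Definition contraction (C : numClosedFieldType) (M : 'M[C]_2) :=
  forall v, sqnorm (M *m v) <= sqnorm v.

Definition mat2 (C : numClosedFieldType) (a b c d : C) : 'M[C]_2 :=
  \matrix_(i, j) if i == 0 then if j == 0 then a else b
                 else if j == 0 then c else d.

Definition su2 (C : numClosedFieldType) (x y : C) : 'M[C]_2 :=
  mat2 x (- y^*) y x^*.

Lemma sum_ord2 (V : nmodType) (F : 'I_2 -> V) : \sum_i F i = F 0 + F 1.
Proof. by rewrite big_ord_recl big_ord1; congr (_ + F _); apply/val_inj. Qed.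

Lemma mat2_mul (C : numClosedFieldType) (a b c d a' b' c' d' : C) :
  mat2 a b c d *m mat2 a' b' c' d' =
  mat2 (a * a' + b * c') (a * b' + b * d') (c * a' + d * c') (c * b' + d * d').
Proof.
apply/matrixP => i j; rewrite !mxE sum_ord2 !mxE /=.
by case: (i == 0); case: (j == 0).
Qed.

Lemma sqnorm_mat2 (C : numClosedFieldType) (a b c d : C) (v : 'cV[C]_2) :
  sqnorm (mat2 a b c d *m v) =
  `|a * v 0 0 + b * v 1 0| ^+ 2 + `|c * v 0 0 + d * v 1 0| ^+ 2.
Proof. by rewrite /sqnorm sum_ord2 !mxE !sum_ord2 !mxE. Qed.

Lemma tr_mat2 (C : numClosedFieldType) (a b c d : C) :
  \tr (mat2 a b c d) = a + d.
Proof. by rewrite /mxtrace sum_ord2 !mxE. Qed.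

Lemma det_mat2 (C : numClosedFieldType) (a b c d : C) :
  \det (mat2 a b c d) = a * d - b * c.
Proof.
rewrite (expand_det_row _ 0) sum_ord2 /cofactor !det_mx11 !mxE /=.
by rewrite expr0 expr1; ring.
Qed.

Lemma sqnorm_su2 (C : numClosedFieldType) (x y : C) (v : 'cV[C]_2) :
  `|x| ^+ 2 + `|y| ^+ 2 = 1 -> sqnorm (su2 x y *m v) = sqnorm v.
Proof.
move=> xy; rewrite sqnorm_mat2 -[RHS]mul1r -xy /sqnorm sum_ord2 !normCK.
rewrite !rmorphD !rmorphM !rmorphN /= !conjCK.
by ring.
Qed.

Lemma su2K (C : numClosedFieldType) (x y : C) :
  `|x| ^+ 2 + `|y| ^+ 2 = 1 -> su2 x y *m su2 x^* (- y) = 1%:M.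
Proof.
rewrite !normCK => xy; rewrite mat2_mul rmorphN /= !conjCK.
apply/matrixP => i j; rewrite !mxE.
case: i => [[|[|//]] ?]; case: j => [[|[|//]] ?] /=; rewrite -?xy; ring.
Qed.

Lemma unit_phase (C : numClosedFieldType) (z : C) :
  exists2 e : C, `|e| = 1 & z = `|z| * e.
Proof.
have [-> | z0] := eqVneq z 0; first by exists 1; rewrite ?normr1 // normr0 mul0r.
exists (z / `|z|); first by rewrite normrM normfV normr_id divff // normr_eq0.
by rewrite mulrC divfK // normr_eq0.
Qed.

(** With [`|x| ^+ 2 = t] and [`|y| ^+ 2 = 1 - t], the phases of [x] and [y] can
    be chosen so that [a * x ^+ 2] and [b * y ^+ 2] have the argument of
    [w * a]; the left-hand side then has modulus [`|a| * t - `|b| * (1 - t)], an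
    affine function of [t] that equals [`|w * a|] for some [t] in [0, 1]. *)
Lemma quad_form_shrink (C : numClosedFieldType) (a b w : C) :
  `|w| <= 1 ->
  exists x y : C, `|x| ^+ 2 + `|y| ^+ 2 = 1 /\ a * x ^+ 2 - b * y ^+ 2 = w * a.
Proof.
move=> w1; have [ea ea1 aE] := unit_phase a; have [eb eb1 bE] := unit_phase b.
have [ew ew1 wE] := unit_phase w.
have eb0 : eb != 0 by rewrite -normr_eq0 eb1 oner_eq0.
have [ab0 | ab0] := eqVneq (`|a| + `|b|) 0.
  exists 1, 0; move/eqP: ab0; rewrite paddr_eq0 // !normr_eq0.
  move=> /andP[/eqP -> /eqP ->].
  by rewrite normr1 normr0; split; ring.
have ab_gt0 : 0 < `|a| + `|b| by rewrite lt0r ab0 addr_ge0.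
pose t := (`|w| * `|a| + `|b|) / (`|a| + `|b|).
have t0 : 0 <= t by rewrite divr_ge0 // ?addr_ge0 // mulr_ge0.
have t1 : t <= 1 by rewrite ler_pdivrMr // mul1r lerD2r ler_piMl.
have tE : t * (`|a| + `|b|) = `|w| * `|a| + `|b| by rewrite /t divfK.
clearbody t.
exists (sqrtC (ew * t)), (sqrtC (ew * ea / eb * (1 - t))).
rewrite -!normrX !sqrtCK !normrM normfV ew1 ea1 eb1 !mul1r invr1 mul1r.
rewrite !ger0_norm ?subr_ge0 //; split; first by ring.
transitivity (ew * ea * (t * (`|a| + `|b|) - `|b|)).
  by rewrite {1}aE {1}bE; field.
by rewrite tE [in RHS]wE [in RHS]aE; ring.
Qed.

(** Conjugation by a unitary matrix preserves contractivity, trace and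
    determinant, while it turns the entry [a] into [a * x ^+ 2 - b * y ^+ 2], a
    quantity that takes every value [w * a] with [`|w| <= 1]. *)
Lemma contraction_shrink (C : numClosedFieldType) (h a b w : C) :
  `|w| <= 1 -> contraction (mat2 h b a h) ->
  exists M : 'M[C]_2, [/\ contraction M, M 1 0 = w * a,
    \tr M = \tr (mat2 h b a h) & \det M = \det (mat2 h b a h)].
Proof.
move=> w1 cM; have [x [y [xy q]]] := quad_form_shrink a b w1.
have xy' : `|x^*| ^+ 2 + `|- y| ^+ 2 = 1 by rewrite norm_conjC normrN.
exists (su2 x^* (- y) *m mat2 h b a h *m su2 x y); split.
- move=> v; rewrite -!mulmxA sqnorm_su2 //.
  by apply: le_trans (cM _) _; rewrite sqnorm_su2.
- rewrite !mat2_mul mxE /= conjCK -q; ring.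
- by rewrite -mulmxA mxtrace_mulC -mulmxA su2K // mulmx1.
- have := congr1 determinant (su2K xy); rewrite det1 det_mulmx => dV.
  by rewrite !det_mulmx -mulrAC [X in X * _]mulrC dV mul1r.
Qed.

Lemma cauchy_schwarz2 (C : numClosedFieldType) (x1 x2 y1 y2 : C) :
  `|x1^* * y1 + x2^* * y2| ^+ 2 <=
  (`|x1| ^+ 2 + `|x2| ^+ 2) * (`|y1| ^+ 2 + `|y2| ^+ 2).
Proof.
rewrite -subr_ge0.
(* Lagrange's identity. *)
rewrite [leRHS](_ : _ = `|x1 * y2 - x2 * y1| ^+ 2) ?exprn_ge0 //.
rewrite !normCK !(rmorphB, rmorphD, rmorphM) /= !conjCK; ring.
Qed.

(** * A matrix-valued inner function realizing the triple *)

Lemma reflect_circle (R : realType) (n : nat) (g : {poly Cx R}) (z : Cx R) :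
  (size g <= n.+1)%N -> circle z ->
  (reflect_poly n g).[z] = z ^+ n * (g.[z])^*.
Proof.
rewrite /circle /= => sg z1.
have z0 : z != 0 by rewrite -normr_eq0 z1 oner_eq0.
rewrite horner_reflect //; congr (_ * (g.[_])^*).
have /eqP zz : z * z^* == 1 by rewrite -normCK z1 expr1n.
have c0 : z^* != 0 by rewrite conjC_eq0.
by rewrite -zz mulfK.
Qed.

(** On the circle [E ^+ 2 = z ^+ n * `|E| ^+ 2], and likewise [A] and [D] times
    their reflections are [z ^+ n] times their squared moduli, so there the
    identity is the hypothesis on [`|A| ^+ 2]. The maximum principle with bound 0
    carries it into the disc. *)
Lemma det_realization (R : realType) (n : nat) (A E D : {poly Cx R}) :
  (size A <= n.+1)%N -> (size E <= n.+1)%N -> (size D <= n.+1)%N ->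
  reflect_poly n E = E ->
  (forall z, circle z ->
     `|A.[z]| ^+ 2 = `|D.[z]| ^+ 2 - 4^-1 * `|E.[z]| ^+ 2) ->
  forall z, disc z ->
  E.[z] ^+ 2 / 4 + A.[z] * (reflect_poly n A).[z] =
  D.[z] * (reflect_poly n D).[z].
Proof.
move=> sA sE sD symE nA z z1.
pose H := 4^-1 *: E ^+ 2 + A * reflect_poly n A - D * reflect_poly n D.
have HE u : H.[u] = E.[u] ^+ 2 / 4 + A.[u] * (reflect_poly n A).[u]
                    - D.[u] * (reflect_poly n D).[u].
  by rewrite /H !hornerE /=; ring.
apply/eqP; rewrite -subr_eq0 -HE -normr_le0.
apply: poly_max_principle z1 => u u1; rewrite normr_le0 HE.
have Eu : E.[u] = u ^+ n * E.[u]^* by rewrite -{1}symE reflect_circle.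
rewrite expr2 {2}Eu !reflect_circle //.
have := nA u u1; rewrite !normCK => /eqP; rewrite -subr_eq0 => /eqP e.
rewrite [eqbLHS](_ : _ = u ^+ n * (A.[u] * A.[u]^* -
  (D.[u] * D.[u]^* - 4^-1 * (E.[u] * E.[u]^*)))); last by field.
by rewrite e mulr0.
Qed.

(** [d] times a unitary matrix: at a point [z] of the circle, with
    [zeta = z ^+ n], the relation [e = zeta * e^*] makes the two columns
    orthogonal and the last hypothesis gives both the norm [`|d|]. *)
Lemma realization_isometry (C : numClosedFieldType) (e a d zeta x y : C) :
  `|zeta| = 1 -> e = zeta * e^* ->
  `|a| ^+ 2 = `|d| ^+ 2 - 4^-1 * `|e| ^+ 2 ->
  `|e / 2 * x + - (zeta * a^*) * y| ^+ 2 + `|a * x + e / 2 * y| ^+ 2 =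
  `|d| ^+ 2 * (`|x| ^+ 2 + `|y| ^+ 2).
Proof.
move=> z1 eE aE.
have zz : zeta * zeta^* = 1 by rewrite -normCK z1 expr1n.
have ec : e^* = zeta^* * e by rewrite {2}eE mulrA [zeta^* * _]mulrC zz mul1r.
have -> : `|d| ^+ 2 = `|a| ^+ 2 + 4^-1 * `|e| ^+ 2 by rewrite aE subrK.
rewrite !normCK !(rmorphB, rmorphD, rmorphN, rmorphM, fmorphV, rmorph_nat) /=.
rewrite !conjCK ec.
(* The cross terms cancel up to a multiple of [1 - zeta * zeta^*]. *)
transitivity (a * a^* * (x * x^*) + (zeta * zeta^*) * (a * a^*) * (y * y^*) +
              e * (zeta^* * e) / 4 * (x * x^* + y * y^*) +
              (1 - zeta * zeta^*) * (e / 2 * (a^* * (y * x^*)))).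
  by field.
by rewrite zz; field.
Qed.

(** The matrix [F.[z]] is unitary on the circle, and contractive inside by the
    maximum principle. For a vector [v] and [w := F.[z0] *m v], the scalar
    function [z |-> <F.[z] *m v, w>] has the form [P / D] and is bounded by
    [`|v| * `|w|] on the circle; at [z0] it equals [`|w| ^+ 2], so that
    [`|w| <= `|v|]. *)
Lemma realization_contraction (R : realType) (n : nat) (A E D : {poly Cx R}) :
  (size A <= n.+1)%N -> (size E <= n.+1)%N -> reflect_poly n E = E ->
  (forall z, closed_disc z -> D.[z] != 0) ->
  (forall z, circle z ->
     `|A.[z]| ^+ 2 = `|D.[z]| ^+ 2 - 4^-1 * `|E.[z]| ^+ 2) ->
  forall z, disc z ->
  contraction (mat2 (E.[z] / D.[z] / 2) (- ((reflect_poly n A).[z] / D.[z]))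
                    (A.[z] / D.[z]) (E.[z] / D.[z] / 2)).
Proof.
move=> sA sE symE D0 nA z z1 v; rewrite sqnorm_mat2 /sqnorm sum_ord2.
set x := v 0 0; set y := v 1 0; set B := reflect_poly n A.
set w1 := _ * x + _ * y; set w2 := _ * x + _ * y.
pose S := `|w1| ^+ 2 + `|w2| ^+ 2; pose N := `|x| ^+ 2 + `|y| ^+ 2.
rewrite -/S -/N.
have S0 : 0 <= S by rewrite addr_ge0 ?exprn_ge0.
have N0 : 0 <= N by rewrite addr_ge0 ?exprn_ge0.
have Dz : D.[z] != 0 by apply: D0; rewrite /closed_disc /= ltW.
pose P := w1^* *: ((x / 2) *: E - y *: B) + w2^* *: (x *: A + (y / 2) *: E).
have PE u : P.[u] = w1^* * (E.[u] / 2 * x + - B.[u] * y) +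
                    w2^* * (A.[u] * x + E.[u] / 2 * y).
  by rewrite /P !hornerE /=; ring.
pose c := sqrtC (S * N).
have c0 : 0 <= c by rewrite sqrtC_ge0 mulr_ge0.
have : `|P.[z]| <= c * `|D.[z]|.
  apply: max_principle z1 => // u u1.
  rewrite -(@ler_pXn2r _ 2) ?nnegrE ?mulr_ge0 //.
  rewrite PE; apply: le_trans (cauchy_schwarz2 _ _ _ _) _.
  rewrite -/S exprMn sqrtCK /B reflect_circle //.
  rewrite (@realization_isometry _ _ _ D.[u]).
  - by rewrite -/N [X in _ * X]mulrC mulrA lexx.
  - by rewrite normrX u1 expr1n.
  - by rewrite -reflect_circle // symE.
  - exact: nA.
(* [w1] and [w2] are the values at this very [z]. *)
have -> : P.[z] = S * D.[z].
  have -> : S = w1^* * w1 + w2^* * w2 by rewrite /S !normCK; ring.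
  by rewrite PE mulrDl -!mulrA /w1 /w2; congr (_ * _ + _ * _); field.
rewrite normrM ler_pM2r ?normr_gt0 // ger0_norm // => Sc.
have [-> // | Sn0] := eqVneq S 0.
have S_gt0 : 0 < S by rewrite lt0r Sn0.
by rewrite -(ler_pM2l S_gt0) -[S * N]sqrtCK -/c -expr2 ler_pXn2r ?nnegrE.
Qed.

(** * Contractions and the closed pentablock *)

Lemma sqnorm_vnorm (R : realType) (v : 'cV[Cx R]_2) :
  sqnorm v = real_complex R (\sum_i ComplexField.Normc.normc (v i 0) ^+ 2).
Proof. by rewrite rmorph_sum; apply: eq_bigr => i _; rewrite rmorphXn. Qed.

Lemma vnorm_contraction (R : realType) (M : 'M[Cx R]_2) (v : 'cV[Cx R]_2) :
  contraction M -> vnorm (M *m v) <= vnorm v.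
Proof.
by move=> /(_ v); rewrite !sqnorm_vnorm lecR => h; rewrite /vnorm ler_wsqrtr.
Qed.

Lemma vnormZ (R : realType) (r : R) (v : 'cV[Cx R]_2) :
  0 <= r -> vnorm ((real_complex R r : Cx R) *: v) = r * vnorm v.
Proof.
move=> r0; rewrite /vnorm -[X in X * _](ger0_norm r0) -sqrtr_sqr -sqrtrM ?sqr_ge0 //.
rewrite mulr_sumr; congr (Num.sqrt _); apply: eq_bigr => i _.
rewrite mxE ComplexField.Normc.normcM exprMn; congr (_ ^+ 2 * _).
by rewrite /= expr0n addr0 sqrtr_sqr ger0_norm.
Qed.

Lemma opnorm_scaled_contraction (R : realType) (M : 'M[Cx R]_2) (r : R) :
  contraction M -> 0 <= r -> opnorm ((real_complex R r : Cx R) *: M) <= r.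
Proof.
move=> cM r0; apply: ge_sup.
  exists (vnorm (((real_complex R r : Cx R) *: M) *m 0)), 0 => //=.
  by rewrite /vnorm; under eq_bigr do rewrite mxE ComplexField.Normc.normc0 expr0n;
     rewrite big1 // sqrtr0 ler01.
move=> _ [v /= v1 <-]; rewrite -scalemxAl vnormZ // -[leRHS]mulr1 ler_wpM2l //.
by apply: le_trans v1; apply: vnorm_contraction.
Qed.

Lemma continuous_pair (T U V : topologicalType) (f : T -> U) (g : T -> V) (x : T) :
  {for x, continuous f} -> {for x, continuous g} ->
  {for x, continuous (fun t => (f t, g t))}.
Proof. by move=> cf cg; exact: (cvg_pair cf cg). Qed.

(** The points of the multiples [r *: M] with [0 <= r < 1] lie in the pentablock
    and tend to the point of [M] as [r] tends to 1. *)
Lemma closure_pentablock (R : realType) (M : 'M[Cx R]_2) :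
  contraction M -> closure (@pentablock R) (M 1 0, \tr M, \det M).
Proof.
move=> cM.
pose g (t : Cx R) : Cx R * Cx R * Cx R := (t * M 1 0, t * \tr M, t * (t * \det M)).
have -> : (M 1 0, \tr M, \det M) = g 1 by rewrite /g !mul1r.
have g_cont : {for 1, continuous g}.
  apply: continuous_pair; first apply: continuous_pair.
  - by apply: continuousM; [exact: cvg_id|exact: cst_continuous].
  - by apply: continuousM; [exact: cvg_id|exact: cst_continuous].
  apply: continuousM; first exact: cvg_id.
  by apply: continuousM; [exact: cvg_id|exact: cst_continuous].
move=> U /g_cont /nbhs_ballP[e /= e0 eU].
have /complex_realP[e' eE] : (e : R[i]) \is Num.real by exact: gtr0_real.
have e'0 : 0 < e' by rewrite -ltcR -eE.
pose r : R := 1 - Num.min (e' / 2) 2^-1.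
have r0 : 0 <= r by rewrite subr_ge0 ge_min invf_le1 ?ltr0n ?ler1n ?orbT.
have r1 : r < 1 by rewrite ltrBlDr ltrDl lt_min divr_gt0 ?invr_gt0 ?ltr0n.
exists (g (real_complex R r)); split; last first.
  apply: eU; rewrite /ball /= /r eE.
  rewrite rmorphB rmorph1 opprB addrCA subrr addr0 normc_def /= expr0n addr0.
  rewrite sqrtr_sqr ltcR ger0_norm ?le_min ?divr_ge0 ?ltW ?invr_gt0 // gt_min.
  by rewrite ltr_pdivrMr // ltr_pMr // ltr1n.
exists ((real_complex R r : Cx R) *: M).
  by apply: le_lt_trans (opnorm_scaled_contraction cM r0) r1.
by rewrite /g mxE mxtraceZ detZ mulrA.
Qed.

(** * Rational functions on the disc *)

Lemma derivable_poly (K : numFieldType) (p : {poly K}) (z : K) :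
  derivable (fun u => p.[u]) z 1.
Proof.
elim/poly_ind: p => [|p c IH].
  by under eq_fun do rewrite horner0; exact: derivable_cst.
under eq_fun do rewrite hornerD hornerM hornerX hornerC.
apply: derivableD; last exact: derivable_cst.
by apply: derivableM => //; exact: derivable_id.
Qed.

Lemma continuous_poly (K : numFieldType) (p : {poly K}) :
  continuous (fun z : K => p.[z]).
Proof.
move=> z; apply: differentiable_continuous.
exact/derivable1_diffP/derivable_poly.
Qed.

Lemma continuous_quotient (R : realType) (P Q : {poly Cx R}) (z : Cx R) :
  Q.[z] != 0 -> {for z, continuous (fun u : Cx R => P.[u] / Q.[u])}.
Proof.
move=> Q0; apply: differentiable_continuous; apply/derivable1_diffP.
by apply: derivableM; [|apply: derivableV => //]; exact: derivable_poly.
Qed.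

(** Cancelling the gcd does not raise degrees; as [Q] does not vanish on the disc,
    neither does the gcd, so no value of [f] is lost. *)
Lemma represents_quotient (R : realType) (f : Cx R -> Cx R)
    (P Q : {poly Cx R}) (k : nat) :
  (size P <= k.+1)%N -> (size Q <= k.+1)%N ->
  (forall z, disc z -> Q.[z] != 0) ->
  (forall z, disc z -> f z = P.[z] / Q.[z]) ->
  exists P' Q', represents f P' Q' /\
    (maxn (size P').-1 (size Q').-1 <= k)%N.
Proof.
move=> sP sQ Q0 fE; pose g := gcdp P Q.
have d0 : disc (0 : Cx R) by rewrite /disc /= normr0 ltr01.
have Qn0 : Q != 0 by apply: contraNneq (Q0 0 d0) => ->; rewrite horner0.
have gP : P %/ g * g = P by rewrite divpK // dvdp_gcdl.
have gQ : Q %/ g * g = Q by rewrite divpK // dvdp_gcdr.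
exists (P %/ g), (Q %/ g); split; last first.
  rewrite geq_max -!subn1 !leq_subLR !add1n.
  by rewrite (leq_trans (leq_divp _ _) sP) (leq_trans (leq_divp _ _) sQ).
split; first by apply: contraNneq Qn0 => e; rewrite -gQ e mul0r.
  by rewrite coprimep_div_gcd // Qn0 orbT.
move=> z z1 Qz; rewrite fE // -{1}gP -{1}gQ !hornerM -mulf_div divff ?mulr1 //.
by apply: contraNneq (Q0 z z1) => gz; rewrite -gQ hornerM gz mulr0.
Qed.

(** At a zero [z] of [Q], the continuous function [f * Q - P] takes the value
    [- P.[z]], nonzero by coprimality; but it vanishes at all the nearby points
    of the disc other than [z], where [Q] has no zero. *)
Lemma represents_denominator_neq0 (R : realType) (f : Cx R -> Cx R)
    (P Q : {poly Cx R}) (z : Cx R) :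
  represents f P Q -> disc z -> {for z, continuous f} -> Q.[z] != 0.
Proof.
move=> [Q0 PQ fE] z1 fz; apply/negP => /eqP Qz.
pose h (u : Cx R) := f u * Q.[u] - P.[u].
have h_cont : {for z, continuous h}.
  apply: continuousB; last exact: continuous_poly.
  by apply: continuousM; [exact: fz | exact: continuous_poly].
have hz : h z != 0.
  rewrite /h Qz mulr0 sub0r oppr_eq0.
  have QP : coprimep Q P by rewrite coprimep_sym.
  by apply: (coprimep_root QP); apply/rootP.
(* [S] is what remains of [Q] without its factors ['X - z]; near [z], the
   zeros of [Q] other than [z] are zeros of [S]. *)
have [m [S]] := multiplicity_XsubC Q z; rewrite Q0 /= => Sz QE.
have [u [hu Su u1 uz]] : exists u, [/\ h u != 0, S.[u] != 0, `|'X.[u]| < 1 & u != z].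
  apply: (@filter_ex _ z^'); near=> u; split; near: u.
  - by apply: nbhs_dnbhs; apply: cvgr_neq0 h_cont hz.
  - by apply: nbhs_dnbhs; apply: cvgr_neq0 (@continuous_poly _ S z) Sz.
  - by apply: nbhs_dnbhs; apply: cvgr_norm_lt (@continuous_poly _ 'X z) _ _;
       rewrite hornerX.
  - exact: nbhs_dnbhs_neq.
rewrite hornerX in u1.
have Qu : Q.[u] != 0.
  by rewrite QE hornerM horner_exp hornerXsubC mulf_neq0 // expf_neq0 // subr_eq0.
by move/eqP: hu; apply; rewrite /h fE // divfK // subrr.
Unshelve. all: by end_near. Qed.

Lemma rational_analytic_quotient (R : realType) (P Q : {poly Cx R}) :
  (forall z, closed_disc z -> Q.[z] != 0) ->
  rational_analytic (fun z => P.[z] / Q.[z]).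
Proof.
move=> Q0; have Qd z : disc z -> Q.[z] != 0 by move=> /ltW; exact: Q0.
split.
- have [P' [Q' [repPQ _]]] := @represents_quotient _ (fun z => P.[z] / Q.[z])
    _ _ (maxn (size P) (size Q)) (leqW (leq_maxl _ _)) (leqW (leq_maxr _ _)) Qd
    (fun z _ => erefl).
  by exists P', Q'.
- move=> z z1; apply: derivableM; first exact: derivable_poly.
  by apply: derivableV; [exact: Qd | exact: derivable_poly].
- by apply: continuous_in_subspaceT => z /[1!inE] z1; apply/continuous_quotient/Q0.
Qed.

Lemma rational_analyticM (R : realType) (f g : Cx R -> Cx R) :
  rational_analytic f -> rational_analytic g ->
  (exists P Q, represents (fun z => f z * g z) P Q) ->
  rational_analytic (fun z => f z * g z).
Proof.
move=> [_ df cf] [_ dg cg] rep; split; first exact: rep.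
  by move=> z z1; apply: derivableM; [exact: df | exact: dg].
by move=> z; apply: continuousM; [exact: cf | exact: cg].
Qed.

Theorem theorem7p9 (R : realType) (m n : nat) (A E D : {poly Cx R})
    (a_in : Cx R -> Cx R)
    (degA : (size A <= n.+1)%N)
    (degE : (size E <= n.+1)%N)
    (degD : (size D <= n.+1)%N)
    (symE : reflect_poly n E = E)
    (D_neq0 : forall z : Cx R, closed_disc z -> D.[z] != 0)
    (E_le_D : forall z : Cx R, closed_disc z -> `|E.[z]| <= 2 * `|D.[z]|)
    (outerA : outer_poly A)
    (normA : forall z : Cx R, circle z ->
       `|A.[z]| ^+ 2 = `|D.[z]| ^+ 2 - 4^-1 * `|E.[z]| ^+ 2)
    (a_in_inner : rational_inner a_in)
    (a_in_deg : exists2 d, rational_degree a_in d & (d <= m)%N) :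
  let x := fun z : Cx R =>
    (a_in z * (A.[z] / D.[z]), E.[z] / D.[z], (reflect_poly n D).[z] / D.[z]) in
  rational_pentablock_inner x /\
  exists2 d, pentablock_degree x d & (d.1 <= m + n)%N /\ (d.2 <= n)%N.
Proof.
move=> x; have [a_in_rat a_in_le1 a_in_circle] := a_in_inner.
have Dd z : disc z -> D.[z] != 0 by move=> /ltW; exact: D_neq0.
have circle_closed (z : Cx R) : circle z -> closed_disc z.
  by rewrite /circle /closed_disc /= => ->.
have [Pa [Qa [rep_a deg_a]]] : exists P Q,
    represents (fun z => a_in z * (A.[z] / D.[z])) P Q /\
    (maxn (size P).-1 (size Q).-1 <= m + n)%N.
  have [d [P [Q [repPQ dE]]] dm] := a_in_deg.
  have [_ da_in _] := a_in_rat.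
  have Qd z : disc z -> Q.[z] != 0.
    move=> z1; apply: (represents_denominator_neq0 repPQ z1).
    by apply: differentiable_continuous; apply/derivable1_diffP/da_in.
  have [_ _ a_inE] := repPQ.
  have szM (S T : {poly Cx R}) :
      (size S <= m.+1)%N -> (size T <= n.+1)%N -> (size (S * T)%R <= (m + n).+1)%N.
    move=> sS sT; apply: leq_trans (size_polyMleq S T) _.
    by rewrite -subn1 leq_subLR add1n -[(m + n).+2]/(m.+1 + n).+1 -addnS leq_add.
  have [sP sQ] : (size P <= m.+1)%N /\ (size Q <= m.+1)%N.
    move: dm; rewrite dE geq_max -!subn1 !leq_subLR !add1n.
    by case/andP.
  apply: (@represents_quotient _ _ (P * A) (Q * D)).
  - exact: szM.
  - exact: szM.
  - by move=> z z1; rewrite hornerM mulf_neq0 ?Qd ?Dd.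
  - by move=> z z1; rewrite a_inE ?Qd // !hornerM mulf_div.
split; last first.
  have [Pp [Qp [rep_p deg_p]]] := @represents_quotient _
    (fun z => (reflect_poly n D).[z] / D.[z]) _ _ n (size_poly _ _) degD Dd
    (fun z _ => erefl).
  exists (maxn (size Pa).-1 (size Qa).-1, maxn (size Pp).-1 (size Qp).-1);
    last by [].
  by split; [exists Pa, Qa | exists Pp, Qp].
split.
- split; [|exact: rational_analytic_quotient|exact: rational_analytic_quotient].
  apply: rational_analyticM; [exact: a_in_rat|exact: rational_analytic_quotient|].
  by exists Pa, Qa.
- move=> z z1.
  (* The number [a_in z] is applied to the entry of the contraction [F.[z]]. *)
  have [M [cM M10 trM detM]] := contraction_shrink (a_in_le1 z z1)
    (realization_contraction degA degE symE D_neq0 normA z1).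
  have -> : x z = (M 1 0, \tr M, \det M); last exact: closure_pentablock.
  rewrite M10 trM detM tr_mat2 det_mat2 /x; congr (_, _, _).
    by field; exact: Dd.
  have := det_realization degA degE degD symE normA z1.
  have := Dd z z1; move: (reflect_poly n D).[z] (reflect_poly n A).[z] => d' a' d0 e.
  have -> : d' = (E.[z] ^+ 2 / 4 + A.[z] * a') / D.[z] by rewrite e mulrC mulKf.
  by field.
- move=> z z1; have Dz := D_neq0 z (circle_closed z z1).
  have nD : `|D.[z]| != 0 by rewrite normr_eq0.
  have zn : `|z ^+ n| = 1 by rewrite normrX z1 expr1n.
  have cD : D.[z]^* != 0 by rewrite conjC_eq0.
  have Ez : E.[z] = z ^+ n * E.[z]^* by rewrite -{1}symE reflect_circle.
  split.
  + rewrite normrM normfV ler_pdivrMr ?normr_gt0 //.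
    by apply: E_le_D; exact: circle_closed.
  + by rewrite reflect_circle // !normrM normfV zn norm_conjC mul1r divff.
  + rewrite reflect_circle // fmorph_div /= {1}Ez; field.
    by rewrite Dz cD.
  + rewrite normrM a_in_circle // mul1r normrM normfV.
    rewrite -[LHS]sqrCK ?divr_ge0 //; congr (sqrtC _).
    by rewrite exprMn exprVn normA // normrM normfV; field.
Qed.
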